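(* There exist universal constants $c,C\in(0,\infty)$ such that for all $d,n\in\mathbb N$ with $n\ge2$ and all $\gamma\in(0,\infty)$, the lifted random walk on $\mathbb Z_n^d$ satisfies $$c\cdot d\cdot\max\bigl(n^2\min(1,\gamma),\gamma^{-1}\bigr)\ \le\ \overline t_{\mathrm{rel}}\ \le\ C\cdot d\cdot\max\bigl(n^2\min(1,\gamma),\gamma^{-1}\bigr).$$
   Context: $\mathbb Z_n^d=\mathbb Z^d/(n\mathbb Z)^d$, and $V=\{\pm e_i:i=1,\dots,d\}$ is the set of the $2d$ signed coordinate directions ($e_i$ the unit vectors in $\mathbb Z^d$; $x+v$ is taken mod $n$). The lifted random walk on $\mathbb Z_n^d$ with rate $\gamma$ is the continuous-time Markov chain with state space $S=\mathbb Z_n^d\times V$ and generator $$\mathcal Lf(x,v)=f(x+v,v)-f(x,v)+\gamma(\Pi f-f)(x,v),\qquad \Pi f(x,v)=\frac1{2d}\sum_{w\in V}f(x,w).$$ Its invariant probability measure is $\mu=\mathrm{Unif}(S)$; $P_t=e^{t\mathcal L}$; $L_0^2(\mu)$ denotes the mean-zero functions in $L^2(\mu)$. With $\overline P_tf=\frac1t\int_0^tP_sf\,\mathrm ds$, $\overline t_{\mathrm{rel}}=\inf\{t\ge0:\|\overline P_s\|_{L_0^2(\mu)\to L_0^2(\mu)}\le1/e\text{ for all }s\ge t\}$. *)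

(* Defs.v *)
From HB Require Import structures.
From mathcomp Require Import all_boot all_order all_algebra.
From mathcomp Require Import all_classical all_reals all_analysis.
Set Implicit Arguments.
Unset Strict Implicit.
Unset Printing Implicit Defensive.
Import Order.TTheory GRing.Theory Num.Theory.
Import numFieldNormedType.Exports.

Local Open Scope classical_set_scope.
Local Open Scope ring_scope.

(* Only meaningful for [1 < n]: ['Z_0] and ['Z_1] both denote Z/2Z. *)
Definition torus (d n : nat) : finType := 'rV['Z_n]_d.

(* [(i, false)] encodes the direction [e_i] and [(i, true)] the direction
   [- e_i].  These are 2d distinct velocities, even for [n = 2], when [e_i] and
   [- e_i] induce the same displacement. *)
Definition velocity (d : nat) : finType := ('I_d * bool)%type.

Definition direction (d : nat) (v : velocity d) : 'rV[int]_d :=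
  (-1) ^+ v.2 *: delta_mx 0 v.1.

Definition translate (d n : nat) (x : torus d n) (v : velocity d) : torus d n :=
  x + map_mx (fun z : int => z%:~R) (direction v).

Definition state (d n : nat) : finType := (torus d n * velocity d)%type.

Definition refresh (R : realType) (d n : nat) (f : state d n -> R) :
    state d n -> R :=
  fun s => (2 * d)%:R^-1 * \sum_(w : velocity d) f (s.1, w).

Definition generator (R : realType) (d n : nat) (gamma : R)
    (f : state d n -> R) : state d n -> R :=
  fun s => f (translate s.1 s.2, s.2) - f s + gamma * (refresh f s - f s).

(* [e^{tL} f] as the exponential series; functions on the finite state space
   form a finite-dimensional space, so that convergence of the series is
   pointwise convergence. *)
Definition semigroup (R : realType) (d n : nat) (gamma t : R)
    (f : state d n -> R) : state d n -> R :=
  fun s => limn (series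
    (fun k => (k`!%:R)^-1 * t ^+ k * iter k (@generator R d n gamma) f s)).

(* The value at [t = 0] (namely 0, because [0^-1 = 0]) is a junk value. *)
Definition time_average (R : realType) (d n : nat) (gamma t : R)
    (f : state d n -> R) : state d n -> R :=
  fun x => t^-1 *
    \int[lebesgue_measure]_(s in `[0, t]) semigroup gamma s f x.

(* Integration with respect to the uniform probability measure. *)
Definition mean (R : realType) (S : finType) (f : S -> R) : R :=
  #|S|%:R^-1 * \sum_(s : S) f s.

Definition L2norm (R : realType) (S : finType) (f : S -> R) : R :=
  Num.sqrt (mean (fun s => f s ^+ 2)).

(* Operator norm on the mean-zero functions of [L^2]. *)
Definition opnorm0 (R : realType) (S : finType)
    (T : (S -> R) -> (S -> R)) : \bar R :=
  ereal_sup [set (L2norm (T f))%:E | f in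
    [set f : S -> R | mean f = 0 /\ L2norm f <= 1]].

(* The infimum is taken in the extended reals, so that it is [+oo] when no [t]
   qualifies.  The junk value of [time_average] at time 0 is harmless: it can
   only matter for the candidate [t = 0], whereas the averages tend to the
   identity, of norm 1, as [s] tends to 0 from the right. *)
Definition relaxation_time (R : realType) (d n : nat) (gamma : R) : \bar R :=
  ereal_inf [set t%:E | t in
    [set t : R | 0 <= t /\
      forall s : R, t <= s ->
        (opnorm0 (@time_average R d n gamma s) <= (expR 1)^-1%:E)%E]].

(* Main.v *)
(* Write L for the generator and M for the maximum in the statement.  Since
   L (int_0^t P_s f ds) = P_t f - f and P_t is a contraction, the relaxation
   time of the time averages is comparable to the norm of the inverse of L on
   mean-zero functions, so the theorem amounts to |f| <= C d M |L f| for every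
   mean-zero f, and to |L g| <= C / (d M) |g| for one nonzero mean-zero g.

   Upper bound.  The energy identity - <f, L f> = D / 2 + gamma Q, where
   D = |f (x + v, v) - f (x, v)|^2 and Q = |f - Pi f|^2, comes with a second
   bound D <= 2 gamma^2 Q + 2 |L f|^2, read off the formula for L f, which is
   better for small gamma.  Along each direction v the Poincare inequality on
   the orbits of x |-> x + v controls f (., v), hence Pi f, by its increments,
   and the variance of Pi f on the torus is at most the sum of the variances
   along the coordinates.  Altogether |f|^2 <= d (3 n^2 D + 7 Q).

   Lower bound.  For phi x = cos (2 pi x_1 / n), put g (., v) = phi if v is not
   parallel to e_1, and otherwise let g (., v) be the solution of
   g (x + v, v) - g (x, v) + gamma (phi x - g (x, v)) = 0.  Then
   L g = gamma (Pi g - phi), a multiple of phi of order gamma / d.  This fails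
   only for d = 1 and gamma n < 1, where g (x, v) = sign v works. *)

Require Import Defs.
From HB Require Import structures.
From mathcomp Require Import all_boot all_order all_algebra.
From mathcomp Require Import all_classical all_reals all_analysis.
From mathcomp Require Import ring lra.
Set Implicit Arguments.
Unset Strict Implicit.
Unset Printing Implicit Defensive.
Import Order.TTheory GRing.Theory Num.Theory.
Import numFieldNormedType.Exports.
Local Open Scope ring_scope.

(** * Exponential generating functions and calculus *)

Section ExponentialSeries.
Variable R : realType.
Implicit Types (a b : nat -> R) (t : R).

(** The terms have the shape of those in [semigroup], so that the semigroup is the [egf] of the
    iterates of the generator; differentiation in [t] shifts [a] by one place. *)
Definition egf a t : R := limn (series (fun k => (k`!%:R)^-1 * t ^+ k * a k)).

Definition geometrically_bounded a : Prop :=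
  exists B r : R, forall k, `|a k| <= B * r ^+ k.

(** Domination by [B] times the exponential series at [|t| * r]. *)
Lemma is_cvg_egf a t : geometrically_bounded a ->
  cvgn (series (fun k => (k`!%:R)^-1 * t ^+ k * a k)).
Proof.
move=> [B [r ab]].
have le k : `|(k`!%:R)^-1 * t ^+ k * a k| <= B * exp_coeff (`|t| * r) k.
  rewrite /exp_coeff /= !normrM normfV normr_nat normrX exprMn.
  rewrite [leRHS](_ : _ = (k`!%:R)^-1 * `|t| ^+ k * (B * r ^+ k)); last by ring.
  by rewrite ler_wpM2l// mulr_ge0 ?invr_ge0 ?exprn_ge0.
apply: normed_cvg; apply: (series_le_cvg _ _ le) => [k|k|].
- exact: normr_ge0.
- exact: le_trans (le k).
- have := is_cvg_seriesZ (k := B) (is_cvg_series_exp_coeff (`|t| * r)).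
  by rewrite (_ : B *: _ = fun k => B * exp_coeff (`|t| * r) k).
Qed.

Lemma egf0 a : egf a 0 = a 0%N.
Proof.
rewrite /egf; apply/cvg_lim => //.
(* The partial sum of index 0 is empty; all later ones equal [a 0]. *)
rewrite -(cvg_shiftn 1) /=.
rewrite (_ : (fun n => _) = cst (a 0%N)); first exact: cvg_cst.
apply/funext => n; rewrite addn1 /series /= big_nat_recl//= big1 => [|i _].
  by rewrite fact0 expr0 invr1 !mul1r addr0.
by rewrite expr0n /= mulr0 mul0r.
Qed.

Lemma geometrically_bounded_shift a : geometrically_bounded a ->
  geometrically_bounded (fun k => a k.+1).
Proof.
move=> [B [r ab]]; exists (B * r), r => k.
by rewrite (le_trans (ab k.+1))// exprS mulrA.
Qed.

Lemma is_derive_egf a t : geometrically_bounded a ->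
  is_derive t (1 : R) (egf a) (egf (fun k => a k.+1) t).
Proof.
move=> ba; pose c k := (k`!%:R)^-1 * a k.
have psE b x : pseries (fun k => (k`!%:R)^-1 * b k) x =
    series (fun k => (k`!%:R)^-1 * x ^+ k * b k).
  by rewrite /pseries; congr series; apply/funext => k /=; ring.
have dE b : pseries_diffs (fun k => (k`!%:R)^-1 * b k) =
    fun k => (k`!%:R)^-1 * b k.+1.
  apply/funext => k; rewrite /pseries_diffs factS natrM invfM.
  by rewrite [_^-1 / _]mulrC -mulrA mulrCA mulVKf ?pnatr_eq0.
have -> : egf a = fun x => limn (pseries c x).
  by apply/funext => x; rewrite psE.
rewrite /egf -psE -dE.
have bS := geometrically_bounded_shift.
(* Termwise differentiation asks for convergence of the series and of its first two formal
   derivatives at a point beyond [|t|]. *)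
apply: (@pseries_snd_diffs _ _ (`|t| + 1)).
- by rewrite psE; exact: is_cvg_egf.
- by rewrite dE psE; apply: is_cvg_egf; exact: bS.
- by rewrite !dE psE; apply: is_cvg_egf; apply: (bS (fun k => a k.+1)); exact: bS.
- by rewrite [ltRHS]ger0_norm ?addr_ge0// ltrDl.
Qed.

Lemma egf_sum (I : finType) (c : I -> R) (a : I -> nat -> R) t :
  (forall i, geometrically_bounded (a i)) ->
  egf (fun k => \sum_i c i * a i k) t = \sum_i c i * egf (a i) t.
Proof.
move=> ba; apply/cvg_lim => //.
rewrite (_ : series _ = fun n => \sum_i c i *
    series (fun k => (k`!%:R)^-1 * t ^+ k * a i k) n); last first.
  apply/funext => n; rewrite /series /=.
  under [RHS]eq_bigr do rewrite mulr_sumr.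
  rewrite exchange_big /=; apply: eq_bigr => k _; rewrite mulr_sumr.
  by apply: eq_bigr => i _; ring.
elim: (index_enum I) => [|i s IHs].
  by rewrite big_nil (_ : (fun _ => _) = cst 0); [exact: cvg_cst|
    apply/funext => n; rewrite big_nil].
rewrite big_cons; under eq_fun do rewrite big_cons.
by apply: cvgD => //; apply: cvgM; [exact: cvg_cst|exact: is_cvg_egf].
Qed.

End ExponentialSeries.

(** * Derivatives, monotonicity and integrals of real functions *)

Section Calculus.
Variable R : realType.

Lemma is_derive_bigsum (I : finType) (F F' : I -> R -> R) (t : R) :
  (forall i, is_derive t (1 : R) (F i) (F' i t)) ->
  is_derive t (1 : R) (fun x => \sum_i F i x) (\sum_i F' i t).
Proof.
move=> dF; rewrite (_ : (fun _ => _) = \sum_i F i); last first.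
  by apply/funext => x; rewrite fct_sumE.
by elim/big_ind2 : _ => // *; [exact: is_derive_cst|exact: is_deriveD].
Qed.

Lemma is_derive_continuous (f : R -> R) (f' t : R) :
  is_derive t (1 : R) f f' -> {for t, continuous f}.
Proof. by move=> df; apply/differentiable_continuous/derivable1_diffP. Qed.

Lemma derive_ge0_le (f f' : R -> R) (t : R) :
  (forall x, is_derive x (1 : R) f (f' x)) ->
  (forall x, 0 <= x -> x <= t -> 0 <= f' x) -> 0 <= t -> f 0 <= f t.
Proof.
move=> df f'0 t0; have [|c /itvP c0t E] := @MVT_segment R f f' 0 t t0 (fun x _ => df x).
  by apply: continuous_subspaceT => x; exact: is_derive_continuous (df x).
by rewrite -subr_ge0 E subr0 mulr_ge0// f'0// c0t.
Qed.

Lemma derive0_cst (f : R -> R) (t : R) :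
  (forall x, is_derive x (1 : R) f 0) -> 0 <= t -> f t = f 0.
Proof.
move=> df t0; have [|c _ E] := @MVT_segment R f (fun=> 0) 0 t t0 (fun x _ => df x).
  by apply: continuous_subspaceT => x; exact: is_derive_continuous (df x).
by apply/eqP; rewrite -subr_eq0 E mul0r.
Qed.

Lemma is_derive_sqr (f : R -> R) (f' x : R) : is_derive x (1 : R) f f' ->
  is_derive x (1 : R) (fun r => f r ^+ 2) (f x *+ 2 * f').
Proof.
move=> df; apply: is_derive_eq (is_deriveM df df) _.
by rewrite /GRing.scale /= -mulrDl mulr2n.
Qed.

Lemma is_derive_quadratic (b c x : R) :
  is_derive x (1 : R) (fun r => b * r + c * r ^+ 2) (b + c * x *+ 2).
Proof.
have D := is_deriveD (is_deriveZ b (is_derive_id x (1 : R)))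
  (is_deriveZ c (is_derive_sqr (is_derive_id x (1 : R)))).
by apply: is_derive_eq D _; rewrite /GRing.scale /= !mulr1 mulrnAr.
Qed.

Lemma Rintegral_FTC (f F : R -> R) (t : R) : 0 < t ->
  (forall x, {for x, continuous f}) ->
  (forall x, is_derive x (1 : R) F (f x)) ->
  \int[lebesgue_measure]_(x in `[0, t]) f x = F t - F 0.
Proof.
move=> t0 cf dF.
have cF x : {for x, continuous F} by exact: is_derive_continuous (dF x).
rewrite /Rintegral (@continuous_FTC2 _ f F)//.
- by apply: continuous_subspaceT => x; exact: cf.
- split=> [x _| |]; first by case: (dF x).
    exact/cvg_at_right_filter/cF.
  exact/cvg_at_left_filter/cF.
- by move=> x _; rewrite derive1E; case: (dF x).
Qed.

End Calculus.

(** * Semigroups of finite generators *)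

Definition kernel_operator (R : realType) (S : finType) (K : S -> S -> R)
  (f : S -> R) : S -> R := fun s => \sum_s' K s s' * f s'.

Section FiniteGenerator.
Variables (R : realType) (S : finType) (K : S -> S -> R).
Implicit Types (f g : S -> R) (s : S) (t : R).

Local Notation L := (kernel_operator K).

Definition heat t f s : R :=
  limn (series (fun k => (k`!%:R)^-1 * t ^+ k * iter k L f s)).

(** The integral of [heat] over [0, t] as a power series: the leading 0 delays the iterates by one
    place, and differentiation removes it. *)
Definition heat_primitive t f s : R :=
  egf (fun k => if k is k'.+1 then iter k' L f s else 0) t.

(** One application of [L] multiplies the l^1 norm by at most [r], the sum of all [|K x y|]. *)
Lemma iter_geometric f s : exists r : R, forall k,
  `|iter k L f s| <= (\sum_x `|f x|) * r ^+ k.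
Proof.
pose r := \sum_x \sum_y `|K x y|; exists r => k.
suff le : \sum_x `|iter k L f x| <= (\sum_x `|f x|) * r ^+ k.
  by apply: le_trans le; rewrite (bigD1 s)//= lerDl sumr_ge0.
elim: k => [|k IHk]; first by rewrite mulr1.
rewrite exprSr mulrA; apply: le_trans (ler_wpM2r _ IHk); last first.
  by apply: sumr_ge0 => x _; exact: sumr_ge0.
rewrite /r mulr_sumr; apply: ler_sum => x _; rewrite iterS /kernel_operator.
apply: (le_trans (ler_norm_sum _ _ _)); rewrite mulr_sumr.
apply: ler_sum => y _; rewrite normrM mulrC ler_wpM2r//.
by rewrite (bigD1 y)//= lerDl sumr_ge0.
Qed.

Lemma iter_geometrically_bounded f s :
  geometrically_bounded (fun k => iter k L f s).
Proof. by have [r fr] := iter_geometric f s; exists (\sum_x `|f x|), r. Qed.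

Lemma heat_commute f t s : heat t (L f) s = L (heat t f) s.
Proof.
rewrite /kernel_operator.
rewrite -(egf_sum (K s) t (fun x => iter_geometrically_bounded f x)) /heat /egf.
congr (limn (series _)); apply/funext => k.
by rewrite -/(L _ s) -iterS iterSr.
Qed.

Lemma is_derive_heat f t s :
  is_derive t (1 : R) (fun t => heat t f s) (heat t (L f) s).
Proof.
have := is_derive_egf t (iter_geometrically_bounded f s).
have -> // : (fun k => iter k.+1 L f s) = fun k => iter k L (L f) s.
by apply/funext => k; rewrite iterSr.
Qed.

Lemma heat0 f s : heat 0 f s = f s.
Proof. exact: (egf0 (fun k => iter k L f s)). Qed.

Lemma heat_primitive0 f s : heat_primitive 0 f s = 0.
Proof. by rewrite /heat_primitive egf0. Qed.

Lemma is_derive_heat_primitive f t s :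
  is_derive t (1 : R) (fun t => heat_primitive t f s) (heat t f s).
Proof.
apply: (@is_derive_egf _ (fun k => if k is k'.+1 then iter k' L f s else 0)).
have [r fr] := iter_geometric f s.
(* Dividing [B] by the ratio makes up for the delay by one index; the ratio [|r| + 1] is surely
   nonzero. *)
pose B := \sum_x `|f x|; exists (B / (`|r| + 1)), (`|r| + 1) => -[|k].
  by rewrite normr0 mulr1 divr_ge0 ?sumr_ge0// addr_ge0.
rewrite exprS mulrA divfK ?gt_eqF ?ltr_wpDl//; apply: (le_trans (fr k)).
rewrite ler_wpM2l ?sumr_ge0//; apply: (le_trans (ler_norm _)).
by rewrite normrX lerXn2r ?nnegrE ?addr_ge0// lerDl.
Qed.

Lemma Rintegral_heat f t s : 0 < t ->
  \int[lebesgue_measure]_(r in `[0, t]) heat r f s = heat_primitive t f s.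
Proof.
move=> t0; have cont x : {for x, continuous (fun r => heat r f s)}.
  exact: is_derive_continuous (is_derive_heat f x s).
rewrite (Rintegral_FTC t0 cont (fun x => is_derive_heat_primitive f x s)).
by rewrite heat_primitive0 subr0.
Qed.

(** As functions of [t] both sides have the same derivative, because [L] commutes with [heat], and
    both vanish at 0. *)
Lemma generator_heat_primitive f t s : 0 <= t ->
  L (heat_primitive t f) s = heat t f s - f s.
Proof.
move=> t0.
have D x : is_derive x (1 : R)
    (fun r => L (heat_primitive r f) s - heat r f s) 0.
  apply: is_derive_eq.
    apply: is_deriveB (is_derive_heat f x s).
    apply: (@is_derive_bigsum _ _ (fun y r => K s y * heat_primitive r f y)
      (fun y r => K s y * heat r f y)) => y.
    exact: is_deriveZ (is_derive_heat_primitive f x y).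
  by rewrite heat_commute subrr.
have := derive0_cst D t0; rewrite heat0.
rewrite {2}/kernel_operator big1 => [|y _]; last by rewrite heat_primitive0 mulr0.
by rewrite sub0r => /eqP; rewrite subr_eq addrC => /eqP.
Qed.

(** Invariance of the counting measure. *)
Hypothesis K_invariant : forall y, \sum_x K x y = 0.

Lemma sum_generator f : \sum_s L f s = 0.
Proof.
rewrite /kernel_operator exchange_big big1 //= => y _.
by rewrite -mulr_suml K_invariant mul0r.
Qed.

Lemma sum_heat f t : 0 <= t -> \sum_s heat t f s = \sum_s f s.
Proof.
move=> t0.
have D x : is_derive x (1 : R) (fun r => \sum_s heat r f s) 0.
  apply: is_derive_eq.
    apply: (@is_derive_bigsum _ _ (fun y r => heat r f y)
      (fun y r => heat r (L f) y)) => y.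
    exact: is_derive_heat.
  by under eq_bigr do rewrite heat_commute; rewrite sum_generator.
by rewrite (derive0_cst D t0); apply: eq_bigr => s _; rewrite heat0.
Qed.

Lemma sum_heat_primitive f t : \sum_s f s = 0 -> 0 <= t ->
  \sum_s heat_primitive t f s = 0.
Proof.
move=> f0 t0.
have D x : is_derive x (1 : R) (fun r => \sum_s heat_primitive r f s)
    (\sum_s heat x f s).
  by apply: (@is_derive_bigsum _ _ (fun y r => heat_primitive r f y)
    (fun y r => heat r f y)) => y; exact: is_derive_heat_primitive.
have E0 : \sum_s heat_primitive 0 f s = 0.
  by rewrite big1// => s _; rewrite heat_primitive0.
(* [sum_heat] makes the derivative vanish at nonnegative times only, whereas [derive0_cst] asks for
   it everywhere; monotonicity on [0, t] of the sum and of its opposite is used instead. *)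
have DN x : is_derive x (1 : R) (fun r => - \sum_s heat_primitive r f s)
  (- \sum_s heat x f s) by exact: is_deriveN.
apply/eqP; rewrite eq_le -oppr_ge0; apply/andP; split.
  have := derive_ge0_le DN _ t0; rewrite E0 oppr0; apply=> x x0 _.
  by rewrite sum_heat// f0 oppr0.
have := derive_ge0_le D _ t0; rewrite E0; apply=> x x0 _.
by rewrite sum_heat// f0.
Qed.

Hypothesis K_dissipative : forall f, \sum_s f s * L f s <= 0.

(** The derivative of |P_t f|^2 is 2 <P_t f, L P_t f>, which is nonpositive by dissipativity. *)
Lemma heat_contraction f t : 0 <= t ->
  \sum_s heat t f s ^+ 2 <= \sum_s f s ^+ 2.
Proof.
move=> t0; rewrite -lerN2.
have D x : is_derive x (1 : R) (fun r => - \sum_s heat r f s ^+ 2)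
    (- \sum_s (heat x f s *+ 2 * heat x (L f) s)).
  apply: is_deriveN.
  apply: (@is_derive_bigsum _ _ (fun y r => heat r f y ^+ 2)
    (fun y r => heat r f y *+ 2 * heat r (L f) y)) => y.
  exact: is_derive_sqr (is_derive_heat f x y).
rewrite [leLHS](_ : _ = - \sum_s heat 0 f s ^+ 2); last first.
  by under [in RHS]eq_bigr do rewrite heat0.
apply: (derive_ge0_le D) => // x x0 _; rewrite oppr_ge0.
under eq_bigr do rewrite heat_commute mulrnAl.
by rewrite sumrMnl mulrn_wle0.
Qed.

(** The gap is applied to u = int_0^t P_s f ds, for which L u = P_t f - f has norm at most 2 |f|. *)
Lemma heat_primitive_bound (kappa : R) f t : 0 <= t ->
  (forall g, \sum_s g s = 0 ->
    \sum_s g s ^+ 2 <= kappa ^+ 2 * \sum_s L g s ^+ 2) ->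
  \sum_s f s = 0 ->
  \sum_s heat_primitive t f s ^+ 2 <= (kappa *+ 2) ^+ 2 * \sum_s f s ^+ 2.
Proof.
move=> t0 gap f0.
apply: (le_trans (gap _ (sum_heat_primitive f0 t0))).
have -> : (kappa *+ 2) ^+ 2 = kappa ^+ 2 * 4 by ring.
rewrite -mulrA ler_wpM2l ?sqr_ge0//.
have -> : \sum_s L (heat_primitive t f) s ^+ 2 =
    \sum_s (heat t f s - f s) ^+ 2.
  by apply: eq_bigr => s _; rewrite generator_heat_primitive.
have : \sum_s (heat t f s - f s) ^+ 2 <=
    \sum_s (heat t f s ^+ 2 *+ 2 + f s ^+ 2 *+ 2).
  by apply: ler_sum => s _; have := sqr_ge0 (heat t f s + f s); nra.
move=> /le_trans; apply; rewrite big_split /= !sumrMnl.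
have := heat_contraction f t0; lra.
Qed.

(** By contraction and Cauchy-Schwarz, <P_r L g, g> >= - eps |g|^2, hence <P_r g, g> >= (1 - eps r)
    |g|^2; this is then integrated over [0, t]. *)
Lemma heat_primitive_lower (eps : R) g t : 0 < eps -> 0 <= t ->
  \sum_s L g s ^+ 2 <= eps ^+ 2 * \sum_s g s ^+ 2 ->
  (t - eps * t ^+ 2 / 2) * (\sum_s g s ^+ 2) <=
    \sum_s heat_primitive t g s * g s.
Proof.
move=> e0 t0 Lg; set N := \sum_s g s ^+ 2 in Lg *.
have heatg r : 0 <= r -> (1 - eps * r) * N <= \sum_s heat r g s * g s.
  move=> r0.
  have D x : is_derive x (1 : R)
      (fun r => \sum_s g s * heat r g s + (eps * N * r + 0 * r ^+ 2))
      (\sum_s g s * heat x (L g) s + (eps * N + 0 * x *+ 2)).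
    apply: is_deriveD; last exact: is_derive_quadratic.
    apply: (@is_derive_bigsum _ _ (fun y r => g y * heat r g y)
      (fun y r => g y * heat r (L g) y)) => y.
    exact: is_deriveZ (is_derive_heat g x y).
  suff H x : 0 <= x -> x <= r ->
      0 <= \sum_s g s * heat x (L g) s + (eps * N + 0 * x *+ 2).
    have := derive_ge0_le D H r0; rewrite !mul0r !mulr0 !addr0.
    under eq_bigr do rewrite heat0 -expr2; rewrite -/N.
    by under [X in _ <= X + _]eq_bigr do rewrite mulrC; lra.
  (* Expanding |P_x L g + eps g|^2 >= 0 and bounding |P_x L g|^2 by eps^2 N gives twice the claim
     multiplied by eps. *)
  move=> x0 _; rewrite mul0r mul0rn addr0 -(pmulr_rge0 _ e0).
  have := heat_contraction (L g) x0.
  have : 0 <= \sum_s (heat x (L g) s + eps * g s) ^+ 2.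
    by apply: sumr_ge0 => s _; exact: sqr_ge0.
  have -> : \sum_s (heat x (L g) s + eps * g s) ^+ 2 =
      \sum_s heat x (L g) s ^+ 2 + eps *+ 2 * (\sum_s g s * heat x (L g) s) +
      eps ^+ 2 * N.
    by rewrite !mulr_sumr -!big_split /=; apply: eq_bigr => s _; ring.
  by move: Lg; rewrite expr2; lra.
have D x : is_derive x (1 : R)
    (fun r => \sum_s g s * heat_primitive r g s + (- N * r + eps * N / 2 * r ^+ 2))
    (\sum_s g s * heat x g s + (- N + eps * N / 2 * x *+ 2)).
  apply: is_deriveD; last exact: is_derive_quadratic.
  apply: (@is_derive_bigsum _ _ (fun y r => g y * heat_primitive r g y)
    (fun y r => g y * heat r g y)) => y.
  exact: is_deriveZ (is_derive_heat_primitive g x y).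
suff H x : 0 <= x -> x <= t ->
    0 <= \sum_s g s * heat x g s + (- N + eps * N / 2 * x *+ 2).
  have := derive_ge0_le D H t0; rewrite expr0n /= !mulr0 !addr0.
  rewrite big1 => [|s _]; last by rewrite heat_primitive0 mulr0.
  by under [X in _ <= X + _]eq_bigr do rewrite mulrC; lra.
move=> x0 _; have := heatg x x0.
by under eq_bigr do rewrite mulrC; lra.
Qed.

End FiniteGenerator.

(** * Averages along orbits *)

(** The sum of (B f - C g)^2 equals B (A B - C^2), which allows division by B; if B = 0, then g
    vanishes. *)
Lemma sum_CauchySchwarz (R : realFieldType) (I : finType) (f g : I -> R) :
  (\sum_i f i * g i) ^+ 2 <= (\sum_i f i ^+ 2) * (\sum_i g i ^+ 2).
Proof.
set A := \sum_i f i ^+ 2; set B := \sum_i g i ^+ 2; set C := \sum_i f i * g i.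
have B0 : 0 <= B by apply: sumr_ge0 => i _; exact: sqr_ge0.
have [/eqP|Bn0] := eqVneq B 0.
  rewrite psumr_eq0 => [/allP g0|i _]; last exact: sqr_ge0.
  rewrite [C]big1 => [|i _].
    by rewrite expr0n mulr_ge0// sumr_ge0// => i _; exact: sqr_ge0.
  by have := g0 i (mem_index_enum i); rewrite sqrf_eq0 => /eqP ->; rewrite mulr0.
have : 0 <= \sum_i (B * f i - C * g i) ^+ 2.
  by apply: sumr_ge0 => i _; exact: sqr_ge0.
have -> : \sum_i (B * f i - C * g i) ^+ 2 = B * (A * B - C ^+ 2).
  suff E p q : \sum_i (p * f i - q * g i) ^+ 2 =
      p ^+ 2 * A - p * q *+ 2 * C + q ^+ 2 * B.
    by rewrite E; ring.
  rewrite !mulr_sumr -sumrN -!big_split /=.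
  by apply: eq_bigr => i _; ring.
by rewrite pmulr_rge0 ?lt_def ?Bn0// subr_ge0.
Qed.

Lemma sqr_sum_le (R : realFieldType) (n : nat) (f : 'I_n -> R) :
  (\sum_i f i) ^+ 2 <= n%:R * \sum_i f i ^+ 2.
Proof.
have := sum_CauchySchwarz f (fun=> 1).
under eq_bigr do rewrite mulr1.
by under [X in _ * X]eq_bigr do rewrite expr1n; rewrite sumr_const card_ord mulrC.
Qed.

(** The length [n] is the same for all orbits; when the [n]-th iterate of [tau] is the identity,
    each orbit is run through a whole number of times. *)
Definition orbit_average (R : realFieldType) (X : Type) (n : nat)
  (tau : X -> X) (u : X -> R) : X -> R :=
  fun x => n%:R^-1 * \sum_(k < n) u (iter k tau x).

Section OrbitAverage.
Variables (R : realFieldType) (X : finType) (n : nat) (tau : X -> X).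
Hypothesis tau_inj : injective tau.
Hypothesis n_gt0 : (0 < n)%N.
Implicit Types u w z : X -> R.

Local Notation E := (orbit_average n tau).

Lemma sum_iter u k : \sum_x u (iter k tau x) = \sum_x u x.
Proof.
elim: k => // k IHk; rewrite -IHk [RHS](reindex_inj tau_inj).
by apply: eq_bigr => x _; rewrite iterSr.
Qed.

Let n0 : n%:R != 0 :> R. Proof. by rewrite pnatr_eq0 -lt0n. Qed.

Let sum_ord_cst (c : R) : n%:R^-1 * \sum_(k < n) c = c.
Proof. by rewrite sumr_const card_ord -[c *+ n]mulr_natl mulKf. Qed.

Lemma sum_orbit_average u : \sum_x E u x = \sum_x u x.
Proof.
rewrite -mulr_sumr exchange_big /=.
by under eq_bigr do rewrite sum_iter; exact: sum_ord_cst.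
Qed.

Lemma sqr_orbit_average_le u x :
  E u x ^+ 2 <= n%:R^-1 * \sum_(k < n) u (iter k tau x) ^+ 2.
Proof.
rewrite exprMn expr2 -mulrA ler_wpM2l ?invr_ge0//.
by rewrite ler_pdivrMl ?ltr0n// sqr_sum_le.
Qed.

Lemma orbit_average_contraction u :
  \sum_x E u x ^+ 2 <= \sum_x u x ^+ 2.
Proof.
apply: le_trans (ler_sum _ (fun x _ => sqr_orbit_average_le u x)) _.
rewrite -mulr_sumr exchange_big /=.
under eq_bigr do rewrite (sum_iter (fun x => u x ^+ 2)).
by rewrite sum_ord_cst.
Qed.

Lemma orbit_averageB u w x : E (fun y => u y - w y) x = E u x - E w x.
Proof. by rewrite /E sumrB mulrBr. Qed.

(** The displacement telescopes into [k] single steps; Cauchy-Schwarz gives one factor [k], and the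
    [k] steps have equal sums of squares. *)
Lemma displacement_le u k :
  \sum_x (u x - u (iter k tau x)) ^+ 2 <=
    k%:R ^+ 2 * \sum_x (u x - u (tau x)) ^+ 2.
Proof.
have le x : (u x - u (iter k tau x)) ^+ 2 <=
    k%:R * \sum_(j < k) (u (iter j tau x) - u (iter j.+1 tau x)) ^+ 2.
  apply: le_trans (sqr_sum_le _).
  suff -> : u x - u (iter k tau x) =
      \sum_(j < k) (u (iter j tau x) - u (iter j.+1 tau x)) by [].
  elim: k => [|k IHk]; first by rewrite big_ord0 subrr.
  by rewrite big_ord_recr /= -IHk addrA subrK.
apply: le_trans (ler_sum _ (fun x _ => le x)) _.
rewrite -mulr_sumr exchange_big /= expr2 -mulrA ler_wpM2l//.
under eq_bigr do rewrite (sum_iter (fun x => (u x - u (tau x)) ^+ 2)).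
by rewrite sumr_const card_ord mulr_natl.
Qed.

(** u - E u is the mean of the displacements over k < n steps, so Jensen's inequality reduces the
    claim to [displacement_le]. *)
Lemma orbit_poincare u :
  \sum_x (u x - E u x) ^+ 2 <= n%:R ^+ 2 * \sum_x (u x - u (tau x)) ^+ 2.
Proof.
have le x : (u x - E u x) ^+ 2 <=
    n%:R^-1 * \sum_(k < n) (u x - u (iter k tau x)) ^+ 2.
  rewrite -{1}(sum_ord_cst (u x)) -mulrBr -sumrB exprMn expr2 -mulrA.
  by rewrite ler_wpM2l ?invr_ge0// ler_pdivrMl ?ltr0n// sqr_sum_le.
apply: le_trans (ler_sum _ (fun x _ => le x)) _.
rewrite -mulr_sumr exchange_big /= -[leRHS]sum_ord_cst.
rewrite ler_wpM2l ?invr_ge0//; apply: ler_sum => k _.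
apply: le_trans (displacement_le u k) _.
rewrite ler_wpM2r ?sumr_ge0// => [x _|]; first exact: sqr_ge0.
by rewrite lerXn2r ?nnegrE// ler_nat ltnW.
Qed.

(** Moving [u] along the orbit changes neither [z] nor the sum of the products. *)
Lemma orbit_average_orthogonal u z : (forall x, z (tau x) = z x) ->
  \sum_x (u x - E u x) * z x = 0.
Proof.
move=> zt; have zk k x : z (iter k tau x) = z x by elim: k => //= k <-.
under eq_bigr do rewrite mulrBl.
rewrite sumrB; apply/eqP; rewrite subr_eq0; apply/eqP.
rewrite -[LHS]sum_ord_cst.
under [RHS]eq_bigr do rewrite -mulrA mulr_suml.
rewrite -mulr_sumr; congr (_ * _); rewrite [RHS]exchange_big /=.
apply: eq_bigr => k _.
rewrite -(sum_iter (fun x => u x * z x) k).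
by apply: eq_bigr => x _; rewrite zk.
Qed.

Hypothesis tau_order : forall x, iter n tau x = x.

(** Applying [tau] rotates the terms of the average cyclically. *)
Lemma orbit_average_invariant u x : E u (tau x) = E u x.
Proof.
congr (_ * _); move: tau_order n_gt0; case: (n) => // m order _.
rewrite [LHS]big_ord_recr [RHS]big_ord_recl -iterSr order addrC.
by congr (_ + _); apply: eq_bigr => i _; rewrite -iterSr.
Qed.

(* [E] is the orthogonal projection onto the [tau]-invariant functions, so
   that [u - E w = (u - E u) + E (u - w)] is an orthogonal decomposition. *)
Lemma orbit_average_pythagoras u w :
  \sum_x (u x - E w x) ^+ 2 <=
    \sum_x (u x - E u x) ^+ 2 + \sum_x (u x - w x) ^+ 2.
Proof.
have -> : \sum_x (u x - E w x) ^+ 2 = \sum_x (u x - E u x) ^+ 2 +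
    (\sum_x (u x - E u x) * E (fun y => u y - w y) x) *+ 2 +
    \sum_x E (fun y => u y - w y) x ^+ 2.
  rewrite -sumrMnl -!big_split /=.
  by apply: eq_bigr => x _; rewrite orbit_averageB; ring.
rewrite orbit_average_orthogonal; last exact: orbit_average_invariant.
by rewrite mul0rn addr0 lerD2l orbit_average_contraction.
Qed.

End OrbitAverage.

(** * Tensorization of the variance for commuting maps *)

Section Tensorization.
Variables (R : realFieldType) (X I : finType) (n : nat) (tau : I -> X -> X).
Hypothesis tau_inj : forall i, injective (tau i).
Hypothesis n_gt0 : (0 < n)%N.
Hypothesis tau_order : forall i x, iter n (tau i) x = x.
Hypothesis tau_comm : forall i j x, tau i (tau j x) = tau j (tau i x).
Hypothesis tau_ergodic : forall z : X -> R,
  (forall i x, z (tau i x) = z x) -> forall x y, z x = z y.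
Implicit Types u w z : X -> R.

Local Notation E := (fun i => orbit_average n (tau i)).

Let avg (s : seq I) u := foldr (fun i w => E i w) u s.

(** The average along [i] creates the invariance, and the averages applied after it commute with
    [tau i]. *)
Let avg_invariant s u i x : i \in s -> avg s u (tau i x) = avg s u x.
Proof.
elim: s x => //= j s IHs x; rewrite inE; have [-> _|_ /= si] := eqVneq i j.
  exact: orbit_average_invariant n_gt0 (tau_order _) _ _.
congr (_ * _); apply: eq_bigr => k _; rewrite -[RHS]IHs//; congr (avg s u _).
by elim: (nat_of_ord k) => //= m ->; exact: tau_comm.
Qed.

Let sum_avg s u : \sum_x avg s u x = \sum_x u x.
Proof. by elim: s => //= i s IHs; rewrite sum_orbit_average. Qed.

(** By [orbit_average_pythagoras] with [w := avg s u], one more average adds only the variance along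
    its own map. *)
Let avg_le s u : \sum_x (u x - avg s u x) ^+ 2 <=
  \sum_(i <- s) \sum_x (u x - E i u x) ^+ 2.
Proof.
elim: s => [|i s IHs] /=.
  by rewrite big_nil big1// => x _; rewrite subrr expr0n.
rewrite big_cons; apply: le_trans (orbit_average_pythagoras _ _ _ _ _) _ => //.
by rewrite lerD2l.
Qed.

(** Averaging along all the maps leaves a constant, by ergodicity, and this constant is 0 because
    [u] has sum zero. *)
Lemma tensorized_variance u : \sum_x u x = 0 ->
  \sum_x u x ^+ 2 <= \sum_i \sum_x (u x - E i u x) ^+ 2.
Proof.
move=> u0; rewrite -[leRHS]big_enum /=; apply: (le_trans _ (avg_le (enum I) u)).
apply: ler_sum => x _.
suff -> : avg (enum I) u x = 0 by rewrite subr0.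
have cst := tau_ergodic (fun i x => avg_invariant u x (mem_enum I i)).
have := sum_avg (enum I) u.
rewrite u0 (eq_bigr (fun=> avg (enum I) u x)) => [|y _]; last exact: cst.
rewrite sumr_const -mulr_natr => /eqP; rewrite mulf_eq0 pnatr_eq0.
rewrite -[_ == 0%N]negbK -lt0n; case/orP => [/eqP//|/negP[]].
by apply/card_gt0P; exists x.
Qed.

End Tensorization.

(** * The generator on the torus *)

Section TorusGeometry.
Variables (d n : nat).
Hypothesis n_ge2 : (2 <= n)%N.

Definition step (v : velocity d) : 'rV['Z_n]_d :=
  map_mx (fun z : int => z%:~R) (direction v).

Lemma stepE v : step v = (-1) ^+ v.2 *: delta_mx 0 v.1.
Proof.
apply/matrixP => i j; rewrite !mxE intrM rmorphXn /= rmorphN1.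
by case: (_ && _).
Qed.

Lemma iter_translate (v : velocity d) (x : torus d n) k :
  iter k (@translate d n ^~ v) x = x + step v *+ k.
Proof. by elim: k => [|k IHk]; rewrite ?addr0//= IHk /translate mulrSr addrA. Qed.

Lemma translate_order (v : velocity d) (x : torus d n) :
  iter n (@translate d n ^~ v) x = x.
Proof.
rewrite iter_translate [step v *+ n](_ : _ = 0) ?addr0//.
apply/matrixP => i j; rewrite mulmxnE -mulr_natr.
by rewrite pchar_Zp// mulr0 mxE.
Qed.

Lemma translate_inj (v : velocity d) : injective (@translate d n ^~ v).
Proof. by move=> x y; exact: addIr. Qed.

Lemma translateAC (v w : velocity d) (x : torus d n) :
  translate (translate x w) v = translate (translate x v) w.
Proof. exact: addrAC. Qed.

(** Invariance under backward unit steps implies invariance under forward ones. Any point is then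
    reached from 0 coordinate by coordinate, each coordinate being read as a natural number of unit
    steps. *)
Lemma translate_ergodic (T : Type) (b : bool) (z : torus d n -> T) :
  (forall i x, z (translate x (i, b)) = z x) -> forall x y, z x = z y.
Proof.
move=> zt; have z1 i x : z (x + delta_mx 0 i) = z x.
  case: b zt => zt; last first.
    by rewrite -[RHS](zt i) /translate -/(step _) stepE expr0 scale1r.
  rewrite -[LHS](zt i) /translate -/(step _) stepE expr1 scaleN1r.
  by rewrite addrK.
have zn i k x : z (x + delta_mx 0 i *+ k) = z x.
  by elim: k => [|k IHk]; rewrite ?addr0// mulrSr addrA z1.
suff z0 x : z x = z 0 by move=> x y; rewrite !z0.
have zs (s : seq 'I_d) y :
    z (y + \sum_(j <- s) x 0 j *: delta_mx 0 j) = z y.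
  elim: s y => [|j s IHs] y; first by rewrite big_nil addr0.
  by rewrite big_cons addrA IHs -[x 0 j]natr_Zp scaler_nat zn.
by rewrite [in LHS](row_sum_delta x) -[X in z X]add0r zs.
Qed.

End TorusGeometry.

(** * Energy identities for the generator *)

Section Generator.
Variables (R : realType) (d n : nat) (gamma : R).
Hypothesis d_gt0 : (0 < d)%N.
Hypothesis n_ge2 : (2 <= n)%N.
Implicit Types f g : state d n -> R.

Local Notation L := (@generator R d n gamma).
Local Notation V := (velocity d).
Local Notation moved f := (fun s : state d n => f (translate s.1 s.2, s.2)).

Lemma sum_state (f : state d n -> R) :
  \sum_s f s = \sum_(v : V) \sum_(x : torus d n) f (x, v).
Proof. by rewrite exchange_big pair_bigA; apply: eq_bigr => -[]. Qed.

Lemma card_velocity : #|V| = (2 * d)%N.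
Proof. by rewrite card_prod card_ord card_bool mulnC. Qed.

Lemma sum_moved f : \sum_s moved f s = \sum_s f s.
Proof.
rewrite !sum_state; apply: eq_bigr => v _ /=.
by rewrite [RHS](reindex_inj (@translate_inj d n v)).
Qed.

(** [refresh] is the conditional expectation given the position. *)
Lemma sum_mul_refresh (h : torus d n -> R) f :
  \sum_s h s.1 * refresh f s = \sum_s h s.1 * f s.
Proof.
rewrite !sum_state exchange_big [RHS]exchange_big /=.
apply: eq_bigr => x _; rewrite -!mulr_sumr /refresh /= sumr_const card_velocity.
congr (_ * _); rewrite -[(\sum_w _) *+ _]mulr_natl mulKf//.
by rewrite pnatr_eq0 muln_eq0 /= -lt0n.
Qed.

Lemma sum_refresh f : \sum_s refresh f s = \sum_s f s.
Proof.
have := sum_mul_refresh (fun=> 1) f.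
by under eq_bigr do rewrite mul1r; under [RHS]eq_bigr do rewrite mul1r.
Qed.

(** The matrix entries are the values of the generator on indicators of points. *)
Lemma generator_kernel :
  L = kernel_operator (fun s s' => L (fun x => (x == s')%:R) s).
Proof.
have delta f (s : state d n) : \sum_s' (s == s')%:R * f s' = f s.
  rewrite (bigD1 s)//= eqxx mul1r big1 ?addr0// => s'.
  by rewrite eq_sym => /negbTE ->; rewrite mul0r.
apply/funext => f; apply/funext => s; rewrite /kernel_operator /generator /refresh.
rewrite -[in LHS](delta f (translate s.1 s.2, s.2)) -[f s in LHS](delta f).
under [X in _ + gamma * (_ * X - _)]eq_bigr do rewrite -(delta f (s.1, _)).
rewrite exchange_big /= [in X in _ + gamma * (X - _)]mulr_sumr.
rewrite -!sumrB mulr_sumr -big_split /=.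
by apply: eq_bigr => s' _; rewrite -mulr_suml; ring.
Qed.

Lemma sum_generator0 f : \sum_s L f s = 0.
Proof.
rewrite /generator big_split /= sumrB sum_moved subrr add0r.
by rewrite -mulr_sumr sumrB sum_refresh subrr mulr0.
Qed.

Definition transport_energy f : R := \sum_s (moved f s - f s) ^+ 2.
Definition refresh_energy f : R := \sum_s (refresh f s - f s) ^+ 2.

Lemma sum_sqr_refresh f :
  \sum_s refresh f s ^+ 2 = \sum_s refresh f s * f s.
Proof.
(* A fixed velocity [v] serves to write [refresh f] as a function of the position; one exists
   because d > 0. *)
case: (pickP V) => [v _|]; last first.
  move=> /eq_card0; rewrite card_velocity => /eqP.
  by rewrite muln_eq0 /= -[d == _]negbK -lt0n d_gt0.
rewrite -[RHS](sum_mul_refresh (fun x => refresh f (x, v)) f).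
by apply: eq_bigr => s _; exact: expr2.
Qed.

Lemma variance_decomposition f :
  \sum_s f s ^+ 2 = \sum_s refresh f s ^+ 2 + refresh_energy f.
Proof.
apply/eqP; rewrite -subr_eq0 /refresh_energy.
have : \sum_s (f s ^+ 2 - (refresh f s ^+ 2 + (refresh f s - f s) ^+ 2)) =
  (\sum_s refresh f s * f s - \sum_s refresh f s ^+ 2) *+ 2.
  by rewrite -sumrB -sumrMnl; apply: eq_bigr => s _; ring.
by rewrite sumrB big_split /= => ->; rewrite sum_sqr_refresh subrr mul0rn.
Qed.

(** Transport preserves the sum of f^2, so its form is minus half the squared increment; [refresh]
    is an orthogonal projection, so its form is minus the squared distance to the range. *)
Lemma energy_identity f : \sum_s f s * L f s =
  - (transport_energy f / 2 + gamma * refresh_energy f).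
Proof.
have E1 : \sum_s f s * (moved f s - f s) = - (transport_energy f / 2).
  apply/eqP; rewrite -addr_eq0 /transport_energy mulr_suml -big_split /=.
  have -> : \sum_s (f s * (moved f s - f s) + (moved f s - f s) ^+ 2 / 2) =
      \sum_s (moved (fun s => f s ^+ 2) s - f s ^+ 2) / 2.
    by apply: eq_bigr => s _ /=; field.
  by rewrite -mulr_suml sumrB [X in X - _](sum_moved (fun s => f s ^+ 2)) subrr mul0r.
have E2 : \sum_s f s * (refresh f s - f s) = - refresh_energy f.
  apply/eqP; rewrite -addr_eq0 /refresh_energy -big_split /=.
  have -> : \sum_s (f s * (refresh f s - f s) + (refresh f s - f s) ^+ 2) =
      \sum_s (refresh f s ^+ 2 - refresh f s * f s).
    by apply: eq_bigr => s _ /=; ring.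
  by rewrite sumrB sum_sqr_refresh subrr.
rewrite opprD -E1 -mulrN -E2 mulr_sumr -big_split /=.
by apply: eq_bigr => s _; rewrite /generator; ring.
Qed.

Lemma transport_energy_le f : transport_energy f <=
  gamma ^+ 2 * refresh_energy f *+ 2 + (\sum_s L f s ^+ 2) *+ 2.
Proof.
rewrite /refresh_energy mulr_sumr -!sumrMnl -big_split /=.
apply: ler_sum => s _; rewrite /generator.
set a := moved f s - f s; set b := refresh f s - f s.
(* The difference of the two sides is exactly this square. *)
have := sqr_ge0 (a + gamma * b *+ 2); lra.
Qed.

Hypothesis gamma_ge0 : 0 <= gamma.

Lemma generator_dissipative f : \sum_s f s * L f s <= 0.
Proof.
rewrite energy_identity oppr_le0 addr_ge0//.
  by rewrite divr_ge0// sumr_ge0// => s _; exact: sqr_ge0.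
by rewrite mulr_ge0// sumr_ge0// => s _; exact: sqr_ge0.
Qed.

End Generator.

(** * The bound on the inverse of the generator *)

Section SpectralGap.
Variables (R : realType) (d n : nat) (gamma : R).
Hypothesis d_gt0 : (0 < d)%N.
Hypothesis n_ge2 : (2 <= n)%N.
Implicit Types f g : state d n -> R.

Local Notation L := (@generator R d n gamma).
Local Notation V := (velocity d).

(** With w = f (., v), m - E m = (w - E w) + (m - w) - E (m - w). The Poincare inequality bounds the
    first term and contraction the last, and three terms cost a factor 3. *)
Lemma variance_along_velocity f (m : torus d n -> R) (v : V) :
  \sum_x (m x - orbit_average n (@translate d n ^~ v) m x) ^+ 2 <=
    3 * n%:R ^+ 2 * (\sum_x (f (translate x v, v) - f (x, v)) ^+ 2) +
    6 * (\sum_x (m x - f (x, v)) ^+ 2).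
Proof.
set E := orbit_average n _; pose w x := f (x, v); have n_gt0 : (0 < n)%N by exact: ltnW.
have inj := @translate_inj d n v.
have P : \sum_x (w x - E w x) ^+ 2 <=
    n%:R ^+ 2 * \sum_x (w (translate x v) - w x) ^+ 2.
  apply: le_trans (orbit_poincare inj n_gt0 w) _.
  rewrite ler_wpM2l ?sqr_ge0//; apply: ler_sum => x _.
  by rewrite -sqrrN opprB.
have C := orbit_average_contraction inj n_gt0 (fun x => m x - w x).
have : \sum_x (m x - E m x) ^+ 2 <= \sum_x (3 * (w x - E w x) ^+ 2 +
    3 * (m x - w x) ^+ 2 + 3 * E (fun x => m x - w x) x ^+ 2).
  apply: ler_sum => x _; rewrite /E orbit_averageB -/E.
  set a := w x - E w x; set b := m x - w x; set c := E m x - E w x.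
  have -> : m x - E m x = a + b - c by rewrite /a /b /c; ring.
  (* The three squares add up to 3 (a^2 + b^2 + c^2) - (a + b - c)^2. *)
  have := sqr_ge0 (a - b); have := sqr_ge0 (a + c); have := sqr_ge0 (b + c).
  nra.
rewrite !big_split /= -!mulr_sumr => /le_trans; apply.
have -> : \sum_x (m x - f (x, v)) ^+ 2 = \sum_x (m x - w x) ^+ 2 by [].
by move: P C; rewrite /w; lra.
Qed.

Lemma refresh_variance_le f : \sum_s f s = 0 ->
  \sum_s refresh f s ^+ 2 <= d%:R *
    (3 * n%:R ^+ 2 * transport_energy f + 6 * refresh_energy f).
Proof.
move=> f0; pose m x := (2 * d)%:R^-1 * \sum_w f (x, w).
have sum_m (F : R -> R) :
    \sum_s F (refresh f s) = (2 * d)%:R * \sum_x F (m x).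
  rewrite sum_state (eq_bigr (fun=> \sum_x F (m x)))//.
  by rewrite sumr_const card_velocity -[LHS]mulr_natl.
have d0 : (2 * d)%:R != 0 :> R by rewrite pnatr_eq0 muln_eq0 /= -lt0n.
have m0 : \sum_x m x = 0.
  have := sum_refresh d_gt0 f; rewrite f0 (sum_m id) => /eqP.
  by rewrite mulf_eq0 (negbTE d0) => /eqP.
have var b : \sum_x m x ^+ 2 <= \sum_i \sum_x
    (m x - orbit_average n (@translate d n ^~ (i, b)) m x) ^+ 2.
  apply: (tensorized_variance (tau := fun i x => translate x (i, b))) => //.
  - by move=> i; exact: translate_inj.
  - exact: ltnW.
  - by move=> i x; exact: translate_order.
  - by move=> i j x; exact: translateAC.
  - by move=> z; exact: translate_ergodic.
rewrite (sum_m (fun r => r ^+ 2)).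
(* Half of the weight 2d goes to each orientation [b] of the axes, so that after tensorization every
   velocity occurs exactly once. *)
have -> : (2 * d)%:R * (\sum_x m x ^+ 2) = d%:R * (\sum_(b : bool) \sum_x m x ^+ 2).
  by rewrite sumr_const card_bool natrM -[_ *+ 2]mulr_natl; ring.
rewrite ler_wpM2l//; apply: le_trans (ler_sum _ (fun b _ => var b)) _.
rewrite exchange_big pair_bigA /= /transport_energy /refresh_energy !sum_state.
rewrite !mulr_sumr -big_split /=; apply: ler_sum => -[i b] _.
exact: variance_along_velocity.
Qed.

Definition time_scale : R := Num.max (n%:R ^+ 2 * Num.min 1 gamma) gamma^-1.

Hypothesis gamma_gt0 : 0 < gamma.

Lemma time_scale_gt0 : 0 < time_scale.
Proof. by rewrite lt_max invr_gt0 gamma_gt0 orbT. Qed.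

Lemma generator_gap f : \sum_s f s = 0 ->
  \sum_s f s ^+ 2 <= (14 * d%:R * time_scale) ^+ 2 * \sum_s L f s ^+ 2.
Proof.
move=> f0; set A := \sum_s f s ^+ 2; set B := \sum_s L f s ^+ 2.
set D := transport_energy f; set Q := refresh_energy f.
have A0 : 0 <= A by apply: sumr_ge0 => s _; exact: sqr_ge0.
have B0 : 0 <= B by apply: sumr_ge0 => s _; exact: sqr_ge0.
have D0 : 0 <= D by apply: sumr_ge0 => s _; exact: sqr_ge0.
have Q0 : 0 <= Q by apply: sumr_ge0 => s _; exact: sqr_ge0.
have d1 : 1 <= d%:R :> R by rewrite ler1n.
have AE : A <= d%:R * (3 * n%:R ^+ 2 * D + 7 * Q).
  rewrite /A (variance_decomposition d_gt0) -/Q.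
  have := refresh_variance_le f0; rewrite -/D -/Q.
  have : Q <= d%:R * Q by rewrite ler_peMl.
  by lra.
pose a := Num.sqrt A; pose b := Num.sqrt B.
have a0 : 0 <= a by exact: sqrtr_ge0.
have b0 : 0 <= b by exact: sqrtr_ge0.
have aE : A = a ^+ 2 by rewrite sqr_sqrtr.
have bE : B = b ^+ 2 by rewrite sqr_sqrtr.
have J : D / 2 + gamma * Q <= a * b.
  have := sum_CauchySchwarz f (L f).
  rewrite (energy_identity gamma d_gt0) -/A -/B -/D -/Q.
  rewrite sqrrN aE bE -exprMn ler_sqr// nnegrE.
    by rewrite addr_ge0 ?mulr_ge0// ltW.
  by rewrite mulr_ge0.
have D2 := transport_energy_le gamma f; rewrite -/D -/Q -/B bE in D2.
set M := time_scale.
have M0 : 0 < M := time_scale_gt0.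
have M1 : n%:R ^+ 2 * Num.min 1 gamma <= M by rewrite le_max lexx.
have M2 : gamma^-1 <= M by rewrite le_max lexx orbT.
have QM : Q <= M * (a * b).
  apply: (@le_trans _ _ (gamma^-1 * (a * b))).
    by rewrite ler_pdivlMl//; lra.
  by rewrite ler_wpM2r// mulr_ge0.
(* For gamma >= 1 this uses D <= 2ab and n^2 <= M. For gamma < 1 it uses D <= 2 gamma a b + 2 b^2,
   n^2 gamma <= M and n^2 <= M^2. *)
have nD : n%:R ^+ 2 * D <= 2 * (M * (a * b)) + 2 * (M ^+ 2 * b ^+ 2).
  have ab0 : 0 <= a * b by exact: mulr_ge0.
  have [g1|g1] := leP 1 gamma.
    have nM : n%:R ^+ 2 <= M by move: M1; rewrite min_l// mulr1.
    have Dab : D <= 2 * (a * b).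
      by have := mulr_ge0 (ltW gamma_gt0) Q0; lra.
    have := ler_pM (sqr_ge0 _) D0 nM Dab.
    have := mulr_ge0 (sqr_ge0 M) (sqr_ge0 b); lra.
  have nM : n%:R ^+ 2 * gamma <= M by move: M1; rewrite min_r// ltW.
  have nMM : n%:R ^+ 2 <= M ^+ 2.
    have -> : n%:R ^+ 2 = n%:R ^+ 2 * gamma * gamma^-1 by rewrite mulfK ?gt_eqF.
    rewrite expr2; apply: ler_pM => //; last by rewrite invr_ge0 ltW.
    by rewrite mulr_ge0 ?sqr_ge0// ltW.
  have Dab : D <= 2 * (gamma * (a * b)) + 2 * b ^+ 2.
    have gQ : gamma * Q <= a * b by lra.
    have := ler_wpM2l (ltW gamma_gt0) gQ; move: D2; rewrite expr2; lra.
  have := ler_wpM2l (sqr_ge0 (n%:R : R)) Dab.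
  have := ler_wpM2r ab0 nM; have := ler_wpM2r (sqr_ge0 b) nMM; lra.
(* 13 = 3 * 2 + 7 and 6 = 3 * 2, from [AE], [nD] and [QM]. *)
have Ad : a ^+ 2 <= 13 * (d%:R * M * (a * b)) + 6 * (d%:R * M ^+ 2 * b ^+ 2).
  rewrite -aE; apply: (le_trans AE).
  have H : 3 * n%:R ^+ 2 * D + 7 * Q <=
      13 * (M * (a * b)) + 6 * (M ^+ 2 * b ^+ 2) by lra.
  have := ler_wpM2l (ler0n R d) H; lra.
rewrite aE bE -exprMn; suff ab : a <= 14 * d%:R * M * b.
  by rewrite lerXn2r ?nnegrE// !mulr_ge0// ltW.
(* If a > 14 k with k = d M b, then a^2 > 13 k a + 6 k^2, whereas [Ad] gives the opposite, d being
   at most d^2. *)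
rewrite leNgt; apply/negP => ab.
set k := d%:R * M * b.
have k0 : 0 <= k by rewrite /k !mulr_ge0// ltW.
have ka : 14 * k < a by move: ab; rewrite /k; lra.
have : a ^+ 2 <= 13 * (k * a) + 6 * k ^+ 2.
  apply: (le_trans Ad).
  have -> : d%:R * M * (a * b) = k * a by rewrite /k; ring.
  have -> : k ^+ 2 = d%:R * (d%:R * M ^+ 2 * b ^+ 2) by rewrite /k; ring.
  have H : 0 <= d%:R * M ^+ 2 * b ^+ 2 by rewrite mulr_ge0 ?sqr_ge0// mulr_ge0 ?sqr_ge0.
  by rewrite lerD2l ler_wpM2l//; exact: ler_peMl.
nra.
Qed.

End SpectralGap.

(** * Relaxation time and the generator *)

Lemma mean_eq0 (R : realType) (S : finType) (f : S -> R) :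
  mean f = 0 -> \sum_s f s = 0.
Proof.
(* The factor [#|S|%:R^-1] is 0 only for empty [S], where the sum is empty. *)
move=> /eqP; rewrite mulf_eq0 invr_eq0 pnatr_eq0 => /orP[/eqP/card0_eq S0|/eqP//].
by rewrite big_pred0.
Qed.

Lemma L2norm_le (R : realType) (S : finType) (f : S -> R) (r : R) : 0 <= r ->
  mean (fun s => f s ^+ 2) <= r ^+ 2 -> L2norm f <= r.
Proof. by move=> r0 fr; rewrite -[leRHS]ger0_norm// -sqrtr_sqr ler_wsqrtr. Qed.

Lemma L2norm_ge (R : realType) (S : finType) (f : S -> R) (r : R) : 0 <= r ->
  r ^+ 2 <= mean (fun s => f s ^+ 2) -> r <= L2norm f.
Proof. by move=> r0 fr; rewrite -[leLHS]ger0_norm// -sqrtr_sqr ler_wsqrtr. Qed.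

Lemma mean_sqr_ge0 (R : realType) (S : finType) (f : S -> R) :
  0 <= mean (fun s => f s ^+ 2).
Proof. by rewrite mulr_ge0 ?invr_ge0// sumr_ge0// => s _; exact: sqr_ge0. Qed.

Section RelaxationTime.
Variables (R : realType) (d n : nat) (gamma : R).
Hypothesis d_gt0 : (0 < d)%N.
Hypothesis n_ge2 : (2 <= n)%N.
Hypothesis gamma_gt0 : 0 < gamma.
Implicit Types f g : state d n -> R.

Local Notation L := (@generator R d n gamma).

Let K : state d n -> state d n -> R := fun s s' => L (fun x => (x == s')%:R) s.

Let LE : L = kernel_operator K. Proof. exact: generator_kernel. Qed.

Lemma time_averageE f t s : 0 < t ->
  time_average gamma t f s = t^-1 * heat_primitive K t f s.
Proof.
move=> t0; rewrite -(Rintegral_heat K f s t0) /time_average; congr (_ * _).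
by congr (Rintegral _ _ _); apply/funext => r; rewrite /semigroup LE.
Qed.

Let K_invariant y : \sum_x K x y = 0. Proof. exact: sum_generator0. Qed.

Let K_dissipative f : \sum_s f s * kernel_operator K f s <= 0.
Proof. by rewrite -LE; apply: generator_dissipative; rewrite ?ltW. Qed.

(** The average at time t has norm at most 2 kappa / t, which is at most 1/e from time 2 kappa e
    on. *)
Lemma relaxation_time_le (kappa : R) : 0 < kappa ->
  (forall g, \sum_s g s = 0 ->
    \sum_s g s ^+ 2 <= kappa ^+ 2 * \sum_s L g s ^+ 2) ->
  (relaxation_time d n gamma <= (kappa *+ 2 * expR 1)%:E)%E.
Proof.
move=> k0 gap; apply: ereal_inf_lbound; exists (kappa *+ 2 * expR 1) => //.
have e0 : 0 < expR 1 :> R := expR_gt0 1.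
have T0 : 0 < kappa *+ 2 * expR 1 by rewrite mulr_gt0// pmulrn_lgt0.
split; first exact: ltW.
move=> t Tt; have t0 := lt_le_trans T0 Tt.
apply: ge_ereal_sup => _ [f [f0 f1] <-]; rewrite lee_fin.
apply: L2norm_le; first by rewrite invr_ge0 ltW.
have fm : mean (fun s => f s ^+ 2) <= 1.
  by move: f1; rewrite -[leRHS]sqrtr1 ler_sqrt// mean_sqr_ge0.
rewrite LE in gap.
have := heat_primitive_bound K_invariant K_dissipative (ltW t0) gap (mean_eq0 f0).
move=> H; have card_ge0 : 0 <= #|state d n|%:R^-1 :> R by rewrite invr_ge0.
have := ler_wpM2l card_ge0 H; rewrite mulrCA -/(mean (fun s => f s ^+ 2)) => {}H.
rewrite /mean; under eq_bigr do rewrite time_averageE// exprMn.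
rewrite -mulr_sumr mulrCA exprVn ler_pdivrMl ?exprn_gt0//.
apply: (le_trans H); apply: (@le_trans _ _ ((kappa *+ 2) ^+ 2)).
  by rewrite ler_piMr ?sqr_ge0.
rewrite -exprMn lerXn2r ?nnegrE ?divr_ge0 ?mulrn_wge0 ?(ltW k0) ?(ltW t0) ?(ltW e0)//.
by rewrite ler_pdivlMr.
Qed.

(** At a time r with eps r < 1, the average of the normalized [g] has inner product at least 1/2
    with it, hence norm at least 1/2 > 1/e. *)
Lemma relaxation_time_ge (eps : R) g : 0 < eps -> \sum_s g s = 0 ->
  0 < \sum_s g s ^+ 2 ->
  \sum_s L g s ^+ 2 <= eps ^+ 2 * \sum_s g s ^+ 2 ->
  ((eps^-1)%:E <= relaxation_time d n gamma)%E.
Proof.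
move=> e0 g0 N0 Lg; apply: le_ereal_inf_tmp => _ [t [t0 tP] <-].
rewrite lee_fin leNgt; apply/negP => te.
(* A midpoint is positive even when t = 0, where [time_average] has its junk value. *)
pose r := (t + eps^-1) / 2.
have tr : t <= r by rewrite /r; lra.
have r0 : 0 < r by rewrite /r; lra.
have er : eps * r < 1 by rewrite mulrC -ltr_pdivlMr// div1r /r; lra.
have card_gt0 : 0 < #|state d n|%:R :> R.
  rewrite ltr0n lt0n; apply/eqP => /card0_eq S0; move: N0.
  by rewrite big_pred0// ltxx.
have m0 : 0 < mean (fun s => g s ^+ 2) by rewrite mulr_gt0 ?invr_gt0.
pose c := (L2norm g)^-1; pose h s := c * g s.
have c2 : c ^+ 2 * (\sum_s g s ^+ 2) = #|state d n|%:R.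
  rewrite /c exprVn sqr_sqrtr ?(ltW m0)// /mean invfM invrK.
  by rewrite mulfVK ?gt_eqF.
have hN : \sum_s h s ^+ 2 = #|state d n|%:R.
  by rewrite -c2 mulr_sumr; apply: eq_bigr => s _; rewrite exprMn.
have h0 : \sum_s h s = 0 by rewrite -mulr_sumr g0 mulr0.
have Lh s : L h s = c * L g s.
  rewrite LE /kernel_operator mulr_sumr.
  by apply: eq_bigr => s' _; rewrite mulrCA.
have Lhe : \sum_s kernel_operator K h s ^+ 2 <= eps ^+ 2 * \sum_s h s ^+ 2.
  rewrite hN -c2 -LE; under eq_bigr do rewrite Lh exprMn.
  by rewrite -mulr_sumr mulrCA ler_wpM2l ?sqr_ge0.
have low := heat_primitive_lower K_dissipative e0 (ltW r0) Lhe.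
have : (L2norm (time_average gamma r h) <= (expR 1)^-1).
  rewrite -lee_fin; apply: le_trans (tP r tr).
  apply: ereal_sup_ubound; exists h => //; split.
    by rewrite /mean h0 mulr0.
  by rewrite /L2norm /mean hN mulVf ?gt_eqF// sqrtr1.
apply/negP; rewrite -ltNge.
have e2 : (expR 1)^-1 < 2^-1 :> R.
  rewrite ltf_pV2 ?posrE ?expR_gt0//.
  by have := @expR_gt1Dx R 1 (oner_neq0 _); rewrite -natr1.
apply: (lt_le_trans e2); apply: L2norm_ge => //.
rewrite /mean; under eq_bigr do rewrite time_averageE// exprMn.
rewrite -mulr_sumr ler_pdivlMl// [r^-1 ^+ 2]exprVn ler_pdivlMl ?exprn_gt0//.
have := sum_CauchySchwarz (fun s => heat_primitive K r h s) h.
rewrite hN; move: low; rewrite hN.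
set N := #|_|%:R; set I := \sum_s _ * _; set Q := \sum_s _ ^+ 2 => low CS.
have low2 : r / 2 * N <= I.
  apply: le_trans low; rewrite ler_wpM2r ?ltW// expr2.
  have := ltr_pM2r r0; move/(_ (eps * r) 1); rewrite er; lra.
rewrite -(ler_pM2r card_gt0); apply: le_trans CS.
have -> : r ^+ 2 * (N * 2^-1 ^+ 2) * N = (r / 2 * N) ^+ 2 by field.
have rN : 0 <= r / 2 * N by exact: mulr_ge0 (divr_ge0 (ltW r0) _) (ltW card_gt0).
by rewrite lerXn2r ?nnegrE ?(le_trans rN low2)//.
Qed.

End RelaxationTime.

(** * A slowly varying function *)

Section Trigonometry.
Variable R : realType.

Lemma sin_le_id (x : R) : 0 <= x -> sin x <= x.
Proof.
move=> x0; have D y : is_derive y (1 : R) (fun r => r - sin r) (1 - cos y).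
  exact: is_deriveB (is_derive_id y (1 : R)) (is_derive_sin y).
have := derive_ge0_le D (fun y _ _ => _) x0.
rewrite sin0 subrr subr_ge0; apply => y.
by rewrite subr_ge0 cos_le1.
Qed.

Variable n : nat.
Hypothesis n_ge2 : (2 <= n)%N.

Definition angle : R := 2 * pi / n%:R.

Definition cosZ (y : 'Z_n) : R := cos (angle * (y : nat)%:R).
Definition sinZ (y : 'Z_n) : R := sin (angle * (y : nat)%:R).

Let n_gt0 : 0 < n%:R :> R. Proof. by rewrite ltr0n ltnW. Qed.

(** Whole turns are split off, so that [cosZ] and [sinZ], defined by representatives, still obey the
    addition formulas. *)
Lemma angle_mod (k : nat) :
  angle * k%:R = angle * (k %% n)%:R + (pi *+ 2) *+ (k %/ n).
Proof.
rewrite {1}(divn_eq k n) natrD natrM /angle -[in RHS]mulr_natl.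
by field; rewrite gt_eqF.
Qed.

Lemma ZnD1 (y : 'Z_n) : (y + 1 : 'Z_n) = (y.+1 %% n)%N :> nat.
Proof.
(* The modulus built into the type ['Z_n] is [n] only up to the equality [Zp_cast]. *)
rewrite -[RHS](congr1 (modn y.+1) (Zp_cast n_ge2)).
by rewrite -[y.+1]addn1 /= modnDmr.
Qed.

Lemma cosZD1 y : cosZ (y + 1) = cosZ y * cos angle - sinZ y * sin angle.
Proof.
rewrite -cosD /cosZ ZnD1 -(periodicn (@cosD2pi R) (y.+1 %/ n)) -angle_mod.
by rewrite -[y.+1]addn1 natrD mulrDr mulr1.
Qed.

Lemma sinZD1 y : sinZ (y + 1) = sinZ y * cos angle + cosZ y * sin angle.
Proof.
rewrite -sinD /sinZ ZnD1 -(periodicn (@sinD2pi R) (y.+1 %/ n)) -angle_mod.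
by rewrite -[y.+1]addn1 natrD mulrDr mulr1.
Qed.

Lemma cosZB1 y : cosZ (y - 1) = cosZ y * cos angle + sinZ y * sin angle.
Proof.
have := cosZD1 (y - 1); have := sinZD1 (y - 1); rewrite subrK => -> ->.
by rewrite -[LHS]mulr1 -(cos2Dsin2 angle); ring.
Qed.

Lemma sinZB1 y : sinZ (y - 1) = sinZ y * cos angle - cosZ y * sin angle.
Proof.
have := cosZD1 (y - 1); have := sinZD1 (y - 1); rewrite subrK => -> ->.
by rewrite -[LHS]mulr1 -(cos2Dsin2 angle); ring.
Qed.

Lemma cos_angle_lt1 : cos angle < 1.
Proof.
have pi0 := @pi_gt0 R.
have a0 : 0 < angle by rewrite divr_gt0// mulr_gt0.
have api : angle <= pi.
  by rewrite ler_pdivrMr// mulrC ler_wpM2l ?(ltW pi0)// ler_nat.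
by rewrite -cos0 ltr_cos// in_itv /= ?lexx ?(ltW pi0) ?(ltW a0).
Qed.

(** The left side is 2 sin(pi/n)^2, and sin(pi/n)^2 <= (4/n)^2 because pi < 4. *)
Lemma one_sub_cos_angle_le : 1 - cos angle <= 32 / n%:R ^+ 2.
Proof.
have pi0 := @pi_gt0 R.
have -> : angle = (pi / n%:R) *+ 2 by rewrite /angle; ring.
rewrite cos_mulr2n cos2sin2.
set x := pi / n%:R; have x0 : 0 <= x by rewrite divr_ge0// ltW.
have xn : x <= 4 / n%:R.
  by rewrite ler_wpM2r ?invr_ge0 ?(ltW n_gt0)//; have := @pihalf_lt2 R; lra.
have sx : sin x ^+ 2 <= x ^+ 2.
  have [xpi|xpi] := leP x pi.
    by rewrite lerXn2r ?nnegrE ?sin_ge0_pi ?x0// sin_le_id.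
  rewrite sin2cos2; have := @pi_ge2 R; have := sqr_ge0 (cos x); nra.
have : x ^+ 2 <= (4 / n%:R) ^+ 2 by rewrite lerXn2r ?nnegrE// divr_ge0// ltW.
have -> : 32 / n%:R ^+ 2 = 2 * (4 / n%:R) ^+ 2 :> R.
  by field; rewrite gt_eqF.
lra.
Qed.

End Trigonometry.

(** * The resolvent of the shift applied to a cosine *)

Section SlowFunction.
Variables (R : realType) (d n : nat) (gamma : R).
Hypothesis n_ge2 : (2 <= n)%N.
Hypothesis gamma_gt0 : 0 < gamma.

Local Notation L := (@generator R d.+1 n gamma).
Local Notation a := (1 - cos (angle R n)).
Local Notation b := (sin (angle R n)).
Local Notation M := (time_scale n gamma).

Let a_gt0 : 0 < a. Proof. by rewrite subr_gt0 cos_angle_lt1. Qed.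

Let a_sqr_le : n%:R ^+ 2 * a <= 32.
Proof.
by rewrite mulrC -ler_pdivlMr ?one_sub_cos_angle_le// exprn_gt0// ltr0n ltnW.
Qed.

(* With theta the angle, gamma / (gamma + 1 - e^(i theta)) = alpha - i beta:
   these are the coefficients of the resolvent of a shift applied to a cosine. *)
Definition slow_denominator : R := gamma ^+ 2 + a * gamma *+ 2 + a *+ 2.
Local Notation Delta := slow_denominator.
Definition slow_cos_coeff : R := gamma * (gamma + a) / Delta.
Definition slow_sin_coeff : R := - (gamma * b / Delta).
Local Notation alpha := slow_cos_coeff.
Local Notation beta := slow_sin_coeff.

Let Delta_gt0 : 0 < Delta.
Proof.
rewrite /Delta; have := a_gt0; have := mulr_gt0 a_gt0 gamma_gt0.
by have := sqr_ge0 gamma; lra.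
Qed.

(** The dimension is [d.+1], with first axis [ord0]. Reversing the direction along it changes the
    sign of the sine term. *)
Definition slow_function (s : state d.+1 n) : R :=
  if s.2.1 == ord0 then
    alpha * cosZ R (s.1 0 ord0) + (-1) ^+ s.2.2 * (beta * sinZ R (s.1 0 ord0))
  else cosZ R (s.1 0 ord0).

Local Notation g := slow_function.

Let one_sub_alpha : 1 - alpha = a * (gamma + 2) / Delta.
Proof.
have D0 : Delta != 0 by rewrite gt_eqF.
rewrite /alpha -[X in X - _](divff D0) -mulrBl; congr (_ / _).
by rewrite /Delta; ring.
Qed.

(** The two velocities along the first axis contribute 2 alpha, their sine terms cancelling, and the
    other 2d contribute 1 each. *)
Lemma refresh_slow s : refresh g s =
  (1 - (1 - alpha) / d.+1%:R) * cosZ R (s.1 0 ord0).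
Proof.
rewrite /refresh -(pair_bigA _ (fun i b => g (s.1, (i, b)))) /= big_ord_recl.
under [X in _ + X]eq_bigr do rewrite big_bool /g /=.
rewrite sumr_const card_ord big_bool /g /= expr0 expr1.
have D0 : d.+1%:R != 0 :> R by rewrite pnatr_eq0.
have dE : d%:R = d.+1%:R - 1 :> R by rewrite -natr1 addrK.
rewrite natrM -[_ *+ d]mulr_natl dE; move: (d.+1%:R : R) D0 => D D0.
by field.
Qed.

Lemma generator_slow s :
  L g s = - (gamma / d.+1%:R * (1 - alpha) * cosZ R (s.1 0 ord0)).
Proof.
rewrite /generator refresh_slow; case: s => x [i e] /=.
have tE : translate x (i, e) 0 ord0 = x 0 ord0 + (-1) ^+ e * (i == ord0)%:R.
  by rewrite /translate -/(step _ _) stepE !mxE /= eq_sym.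
rewrite /g /= tE; set y := x 0 ord0; set C := cosZ R y; set S := sinZ R y.
case: (i == ord0); last first.
  by rewrite mulr0 addr0 -/C; ring.
(* The resolvent equation for the direction t e_1, with t = 1 or -1. The coefficient of S vanishes
   identically, that of C because Delta = (gamma + a)^2 + b^2. *)
have T (t : R) : t ^+ 2 = 1 ->
    alpha * (C * (1 - a) - t * (S * b)) + t * (beta * (S * (1 - a) + t * (C * b)))
    = (1 + gamma) * (alpha * C + t * (beta * S)) - gamma * C.
  move=> t2; have D0 : Delta != 0 by rewrite gt_eqF.
  have b2 : b ^+ 2 = 2 * a - a ^+ 2 by rewrite sin2cos2; ring.
  apply/eqP; rewrite -subr_eq0; apply/eqP.
  have -> : alpha * (C * (1 - a) - t * (S * b)) +
      t * (beta * (S * (1 - a) + t * (C * b))) -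
      ((1 + gamma) * (alpha * C + t * (beta * S)) - gamma * C) =
    C * (gamma - alpha * (gamma + a) + t ^+ 2 * (beta * b)) -
    t * S * (alpha * b + beta * (gamma + a)) by ring.
  have -> : alpha * b + beta * (gamma + a) = 0 by rewrite /alpha /beta; field.
  rewrite t2 mul1r mulr0 subr0.
  have -> : gamma - alpha * (gamma + a) + beta * b =
      gamma * (Delta - (gamma + a) ^+ 2 - b ^+ 2) / Delta.
    by rewrite /alpha /beta; field.
  by rewrite b2 /Delta; ring.
have N1 : (-1) ^+ 2 = 1 :> R by rewrite sqrrN expr1n.
case: e tE => tE; rewrite ?expr1 ?expr0 mulr1.
  rewrite cosZB1// sinZB1//; have := T (-1) N1; rewrite -/C -/S.
  by move: alpha beta (d.+1%:R^-1 : R) => al be D; lra.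
rewrite cosZD1// sinZD1//; have := T 1 (expr1n _ 2); rewrite -/C -/S.
by move: alpha beta (d.+1%:R^-1 : R) => al be D; lra.
Qed.

(** The generator has sum zero, and its value on [g] is a nonzero multiple of the cosine. *)
Lemma sum_cosZ : \sum_(x : torus d.+1 n) cosZ R (x 0 ord0) = 0.
Proof.
have := sum_generator0 gamma (ltn0Sn d) g.
rewrite (eq_bigr _ (fun s _ => generator_slow s)) sumrN -mulr_sumr.
rewrite sum_state /= sumr_const card_velocity -[(\sum_x _) *+ _]mulr_natl.
have c0 : 0 < gamma / d.+1%:R * (1 - alpha).
  by rewrite one_sub_alpha !mulr_gt0 ?invr_gt0 ?ltr0n// addr_gt0.
by move/eqP; rewrite oppr_eq0 mulf_eq0 gt_eqF//= mulf_eq0 pnatr_eq0 => /eqP.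
Qed.

Lemma sum_slow : \sum_s g s = 0.
Proof.
rewrite -(sum_refresh (ltn0Sn d)) (eq_bigr _ (fun s _ => refresh_slow s)).
rewrite -mulr_sumr sum_state /= (eq_bigr (fun=> 0)) => [|v _].
  by rewrite big1 ?mulr0.
exact: sum_cosZ.
Qed.

Local Notation N := (\sum_(x : torus d.+1 n) cosZ R (x 0 ord0) ^+ 2).

Lemma sum_cosZ_sqr_gt0 : 0 < N.
Proof.
rewrite (bigD1 0)//= mxE /cosZ mulr0 cos0 expr1n ltr_wpDr// sumr_ge0// => x _.
exact: sqr_ge0.
Qed.

(** Over each x, the two velocities along the first axis give 2 (alpha C)^2 + 2 (beta S)^2, the
    other 2d give C^2 each. *)
Lemma slow_norm_ge : 2 * (alpha ^+ 2 + d%:R) * N <= \sum_s g s ^+ 2.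
Proof.
rewrite sum_state exchange_big /= mulr_sumr; apply: ler_sum => x _.
rewrite -(pair_bigA _ (fun i b => g (x, (i, b)) ^+ 2)) /= big_ord_recl.
under [X in _ <= _ + X]eq_bigr do rewrite big_bool /g /=.
rewrite sumr_const card_ord big_bool /g /= expr0 expr1 -[_ *+ d]mulr_natl.
set C := cosZ _ _; set S := sinZ _ _.
by have := sqr_ge0 (beta * S); lra.
Qed.

Lemma generator_slow_norm : \sum_s L g s ^+ 2 =
  (gamma / d.+1%:R * (1 - alpha)) ^+ 2 * (2 * d.+1%:R * N).
Proof.
under eq_bigr do rewrite generator_slow sqrrN exprMn.
rewrite -mulr_sumr sum_state /= sumr_const card_velocity.
rewrite -[(\sum_x _) *+ _]mulr_natl.
by rewrite natrM.
Qed.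

(** If M = 1/gamma, alpha >= 0 suffices. Otherwise gamma^2 (1 - alpha) <= a (gamma + 2) yields the
    bound 3 n^2 a, and 96 = 3 * 32. *)
Lemma slow_rate_le : gamma * (1 - alpha) <= 96 / M.
Proof.
have M0 := time_scale_gt0 n gamma_gt0.
have al0 : 0 <= alpha by rewrite ltW// divr_gt0// mulr_gt0// addr_gt0.
have n0 : 0 < n%:R ^+ 2 :> R by rewrite exprn_gt0// ltr0n ltnW.
rewrite ler_pdivlMr// /time_scale.
have [_|_] := leP (n%:R ^+ 2 * Num.min 1 gamma) gamma^-1.
  by rewrite mulrC mulKf ?gt_eqF//; lra.
have rate : gamma * (1 - alpha) * gamma <= a * (gamma + 2).
  rewrite one_sub_alpha.
  have -> : gamma * (a * (gamma + 2) / Delta) * gamma =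
    a * (gamma + 2) * (gamma ^+ 2 / Delta) by ring.
  have H : 0 <= a * (gamma + 2) by rewrite ltW// mulr_gt0// addr_gt0.
  apply: ler_piMr H _; rewrite ler_pdivrMr// mul1r /Delta.
  by have := a_gt0; have := mulr_gt0 a_gt0 gamma_gt0; lra.
have agt := mulr_gt0 a_gt0 gamma_gt0.
rewrite mulrCA; apply: (@le_trans _ _ (n%:R ^+ 2 * (3 * a))).
  rewrite ler_wpM2l ?(ltW n0)//; have [g1|g1] := leP 1 gamma.
    rewrite mulr1 -(ler_pM2r gamma_gt0); apply: (le_trans rate).
    have := mulr_ge0 (ltW a_gt0) (_ : 0 <= gamma - 1).
    by rewrite subr_ge0 => /(_ g1); lra.
  apply: (le_trans rate).
  have := mulr_ge0 (ltW a_gt0) (_ : 0 <= 1 - gamma).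
  by rewrite subr_ge0 => /(_ (ltW g1)); lra.
by have := a_sqr_le; lra.
Qed.

(** Here a <= 32 gamma^2, so Delta <= 65 gamma^2 + 2 a gamma <= 67 gamma (gamma + a). *)
Lemma alpha_ge : 1 <= gamma * n%:R -> 67^-1 <= alpha.
Proof.
move=> gn; rewrite ler_pdivlMr// /Delta.
have gn2 : 1 <= n%:R ^+ 2 * gamma ^+ 2.
  by rewrite -exprMn mulrC exprn_ege1.
have ag : a <= 32 * gamma ^+ 2.
  apply: (@le_trans _ _ (n%:R ^+ 2 * a * gamma ^+ 2)).
    by rewrite mulrAC ler_peMl// ltW.
  by rewrite ler_wpM2r ?sqr_ge0// a_sqr_le.
by have := mulr_gt0 a_gt0 gamma_gt0; have := sqr_ge0 gamma; lra.
Qed.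

(** In dimension one only alpha^2 is available, whence the condition; otherwise d >= (d + 1) / 2 is
    enough. *)
Lemma slow_function_norm : (d = 0%N -> 1 <= gamma * n%:R) ->
  67^-1 ^+ 2 * (2 * d.+1%:R * N) <= \sum_s g s ^+ 2.
Proof.
move=> d0; apply: le_trans slow_norm_ge; have N0 := sum_cosZ_sqr_gt0.
rewrite mulrA ler_wpM2r ?(ltW N0)//.
have := sqr_ge0 alpha.
case: (posnP d) => [d00|d1]; last first.
  have : 1 <= d%:R :> R by rewrite ler1n.
  by rewrite -(natr1 d); lra.
have al : 67^-1 ^+ 2 <= alpha ^+ 2.
  have al := alpha_ge (d0 d00).
  by rewrite lerXn2r ?nnegrE ?(le_trans _ al)//; lra.
rewrite d00 addr0 mulr1 => _.
by move: al; lra.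
Qed.

Lemma slow_function_ratio : (d = 0%N -> 1 <= gamma * n%:R) ->
  \sum_s L g s ^+ 2 <= (67 * 96 / (d.+1%:R * M)) ^+ 2 * \sum_s g s ^+ 2.
Proof.
move=> d0; have M0 := time_scale_gt0 n gamma_gt0.
have D0 : 0 < d.+1%:R :> R by rewrite ltr0n.
rewrite generator_slow_norm.
have -> : (67 * 96 / (d.+1%:R * M)) ^+ 2 = (96 / M / d.+1%:R) ^+ 2 * 67 ^+ 2.
  by rewrite -exprMn; congr (_ ^+ 2); field; rewrite !gt_eqF.
have al0 : 0 <= gamma / d.+1%:R * (1 - alpha).
  by rewrite one_sub_alpha ltW// !mulr_gt0 ?invr_gt0 ?ltr0n// addr_gt0.
rewrite -[leRHS]mulrA; apply: ler_pM.
- exact: sqr_ge0.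
- by rewrite mulr_ge0 ?(ltW sum_cosZ_sqr_gt0)// mulr_ge0.
- rewrite lerXn2r ?nnegrE ?divr_ge0 ?(ltW M0)//.
  by rewrite mulrAC ler_wpM2r ?invr_ge0 ?(ltW D0)// slow_rate_le.
- have := slow_function_norm d0; lra.
Qed.

Lemma slow_function_neq0 : (d = 0%N -> 1 <= gamma * n%:R) ->
  0 < \sum_s g s ^+ 2.
Proof.
move=> /slow_function_norm; apply: lt_le_trans.
by rewrite !mulr_gt0 ?exprn_gt0 ?invr_gt0 ?sum_cosZ_sqr_gt0.
Qed.

End SlowFunction.

Lemma exists_slow_function (R : realType) (d n : nat) (gamma : R) :
  (0 < d)%N -> (2 <= n)%N -> 0 < gamma ->
  exists g : state d n -> R, [/\ \sum_s g s = 0, 0 < \sum_s g s ^+ 2 &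
    \sum_s generator gamma g s ^+ 2 <=
      (67 * 96 / (d%:R * time_scale n gamma)) ^+ 2 * \sum_s g s ^+ 2].
Proof.
case: d => // d _ n2 gam0.
have [gn|gn] := leP 1 (gamma * n%:R).
  exists (slow_function gamma); split; first exact: sum_slow.
    exact: slow_function_neq0.
  exact: slow_function_ratio.
case: (posnP d) => [->|d0]; last first.
  have d1 : d = 0%N -> 1 <= gamma * n%:R by move=> E; rewrite E in d0.
  exists (slow_function gamma); split; first exact: sum_slow.
    exact: slow_function_neq0.
  exact: slow_function_ratio.
pose g (s : state 1 n) : R := (-1) ^+ s.2.2.
have rg s : refresh g s = 0.
  rewrite /refresh -(pair_bigA _ (fun i b => g (s.1, (i, b)))) /= big1 ?mulr0// => i _.
  by rewrite big_bool /g /= expr0 expr1 addNr.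
have g2 s : g s ^+ 2 = 1 by rewrite /g sqrr_sign.
(* n^2 min(1, gamma) gamma <= (gamma n)^2 <= 1. *)
have M1 : time_scale n gamma = gamma^-1.
  apply/max_idPr; rewrite -[leRHS]mul1r ler_pdivlMr//.
  apply: (@le_trans _ _ (n%:R ^+ 2 * gamma * gamma)).
    by rewrite ler_wpM2r ?(ltW gam0)// ler_wpM2l ?sqr_ge0// ge_min lexx orbT.
  rewrite -mulrA -expr2 -exprMn mulrC exprn_ile1// ?ltW//.
  by rewrite mulr_gt0// ltr0n ltnW.
exists g; split.
- by rewrite -(sum_refresh (ltn0Sn 0)) big1.
- under eq_bigr do rewrite g2.
  rewrite sumr_const ltr0n; apply/card_gt0P.
  by exists (0, (ord0, false)).
- rewrite mulr_sumr; apply: ler_sum => s _.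
  have -> : generator gamma g s = - (gamma * g s).
    by rewrite /generator rg /g /=; ring.
  rewrite sqrrN exprMn M1 mul1r invrK g2 !mulr1 exprMn.
  by rewrite ler_peMl ?sqr_ge0//; lra.
Qed.

Theorem theorem21 (R : realType) :
  exists c C : R,
    0 < c /\ 0 < C /\
    forall (d n : nat) (gamma : R),
      (1 <= d)%N -> (2 <= n)%N -> 0 < gamma ->
      ((c * d%:R * Num.max (n%:R ^+ 2 * Num.min 1 gamma) gamma^-1)%:E
         <= relaxation_time d n gamma)%E /\
      (relaxation_time d n gamma
         <= (C * d%:R * Num.max (n%:R ^+ 2 * Num.min 1 gamma) gamma^-1)%:E)%E.
Proof.
(* The lower constant is the inverse of the one in [exists_slow_function]; the upper one is 2e times
   the 14 of [generator_gap]. *)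
exists (67 * 96)^-1, (28 * expR 1); split.
  by rewrite invr_gt0 mulr_gt0 ?ltr0n.
split; first by rewrite mulr_gt0 ?expR_gt0 ?ltr0n.
move=> d n gamma d1 n2 g0; rewrite -/(time_scale n gamma).
have M0 := time_scale_gt0 n g0.
have D0 : 0 < d%:R :> R by rewrite ltr0n.
split.
  have [g [gs gN Lg]] := exists_slow_function d1 n2 g0.
  rewrite -mulrA -[X in X%:E]invrK invfM invrK.
  by apply: (relaxation_time_ge d1 g0) gs gN Lg; rewrite !mulr_gt0 ?invr_gt0 ?mulr_gt0 ?ltr0n.
have k0 : 0 < 14 * d%:R * time_scale n gamma by rewrite !mulr_gt0.
have -> : 28 * expR 1 * d%:R * time_scale n gamma =
  (14 * d%:R * time_scale n gamma) *+ 2 * expR 1 by ring.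
by apply: (relaxation_time_le d1 g0 k0) => g; exact: generator_gap.
Qed.
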